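(* For all positive integers $r$ and $k$, $$\bar T(\{1\}_{r-1},k)=\sum_{j=1}^r(-1)^{j-1}\,\bar T(\{1\}_{r-j})\,W(k+j-1,j),$$ with $\bar T(\emptyset):=1$.
   Context: $\{1\}_a$ denotes the sequence of $a$ ones. For positive integers $k_1,\dots,k_r$, $\bar T(k_1,\ldots,k_r):=2^r\sum_{0<n_1<\cdots<n_r}\frac{(-1)^{n_r}}{(2n_1-1)^{k_1}(2n_2-2)^{k_2}\cdots(2n_r-r)^{k_r}}$. $I(k,r)$ is the set of tuples $(k_1,\dots,k_r)$ of positive integers with sum $k$, and $W(k,r):=\sum_{(k_1,\dots,k_r)\in I(k,r)}\bar T(k_1,\dots,k_r)$. *)

(* Defs.v *)
From HB Require Import structures.
From mathcomp Require Import all_boot all_order all_algebra.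
From mathcomp Require Import all_classical all_reals all_analysis.
Set Implicit Arguments. Unset Strict Implicit. Unset Printing Implicit Defensive.
Import Order.TTheory GRing.Theory Num.Theory.
Import numFieldNormedType.Exports.
Local Open Scope ring_scope.

Definition Tbar_part (R : realType) (ks : seq nat) (N : nat) : R :=
  let r := size ks in
  \sum_(n : r.-tuple 'I_N.+1 |
          sorted ltn (map val n) && all (fun m => 0 < m)%N (map val n))
    2 ^+ r * (-1) ^+ (last 0%N (map val n)) *
    \prod_(i < r)
      ((2 * (nth 0%N (map val n) i)%:R - (i.+1)%:R) ^+ (nth 0%N ks i))^-1.

(* \bar T(k_1,...,k_r): the multiple series, as the limit of the partial sums
   over n_r <= N.  For ks = [::] this is the constant 1 (= \bar T(emptyset)). *)
Definition Tbar (R : realType) (ks : seq nat) : R := limn (Tbar_part R ks).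

Definition W (R : realType) (k r : nat) : R :=
  \sum_(t : r.-tuple 'I_k.+1 |
          all (fun m => 0 < m)%N (map val t) && (sumn (map val t) == k))
    Tbar R (map val t).

(* Main.v *)
Require Import Defs.
From HB Require Import structures.
From mathcomp Require Import all_boot all_order all_algebra.
From mathcomp Require Import all_classical all_reals all_analysis.
From mathcomp Require Import zify ring lra.
Import Order.TTheory GRing.Theory Num.Theory.
Import numFieldNormedType.Exports.
Local Open Scope ring_scope.

(** Give the term of [\bar T(k_1, ..., k_r)] with last index [n_r = n] the
    monomial [y ^ (2 n - r)].  The resulting power series satisfy, for the Euler
    operator [theta = y d/dy] and [u = - 2 y / (1 + y^2)],
    [theta A(.., k + 1) = A(.., k)] for [k > 0] and [theta A(.., 1) = u * A(..)].
    Summing over compositions, [theta W(k, r) = W(k - 1, r) + u * W(k - 1, r - 1)].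
    Applying [theta] to both sides of the claimed identity of power series and
    cancelling on the right by a shift of [j] gives the identity for [k - 1]
    (for [k = 1], the equation of [A({1}_r)]), so it holds by induction on [k].

    At [y = 1] the series converge only conditionally.  Each of them is alternating
    with terms of bounded variation, because the nested sums are [O(sqrt n)].
    The Cauchy products on the right need not converge separately, but their
    partial sums converge in the sense of Cesaro to the product of the limits,
    which is enough since the left-hand side converges. *)

(** * Cauchy products *)

Section CauchyProduct.
Context {A : comNzRingType}.
Implicit Types f g h : nat -> A.

Definition cauchyM f g (n : nat) : A := \sum_(i < n.+1) f i * g (n - i)%N.

Lemma eq_cauchyM f f' g g' n :
  (forall i, (i <= n)%N -> f i = f' i) -> (forall i, (i <= n)%N -> g i = g' i) ->
  cauchyM f g n = cauchyM f' g' n.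
Proof.
move=> ff' gg'; apply: eq_bigr => i _.
by rewrite ff' ?gg' ?leq_subr // -ltnS.
Qed.

(** Truncating beyond degree [n] leaves coefficient [n] of a product unchanged, so commutativity and
    associativity are inherited from polynomials. *)
Lemma cauchyM_polyE f g n m : (n < m)%N ->
  cauchyM f g n = (\poly_(i < m) f i * \poly_(i < m) g i)`_n.
Proof.
move=> nm; rewrite coefM; apply: eq_bigr => i _.
rewrite !coef_poly (leq_trans (ltn_ord i) nm).
by rewrite (leq_ltn_trans (leq_subr _ _) nm).
Qed.

Lemma cauchyMC f g n : cauchyM f g n = cauchyM g f n.
Proof. by rewrite !(@cauchyM_polyE _ _ n n.+1) // mulrC. Qed.

Lemma cauchyM3_polyE f g h n m : (n < m)%N ->
  cauchyM f (cauchyM g h) n =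
  (\poly_(i < m) f i * (\poly_(i < m) g i * \poly_(i < m) h i))`_n.
Proof.
move=> nm; rewrite coefM; apply: eq_bigr => i _.
rewrite coef_poly (leq_trans (ltn_ord i) nm) -cauchyM_polyE //.
exact: leq_ltn_trans (leq_subr _ _) nm.
Qed.

Lemma cauchyMCA f g h n : cauchyM f (cauchyM g h) n = cauchyM g (cauchyM f h) n.
Proof. by rewrite !(@cauchyM3_polyE _ _ _ n n.+1) // mulrCA. Qed.

Lemma cauchyMA f g h n : cauchyM f (cauchyM g h) n = cauchyM (cauchyM f g) h n.
Proof.
rewrite [RHS]cauchyMC [RHS]cauchyMCA.
by apply: eq_cauchyM => // i _; rewrite cauchyMC.
Qed.

Lemma cauchyMDr f g h n :
  cauchyM f (fun m => g m + h m) n = cauchyM f g n + cauchyM f h n.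
Proof. by rewrite -big_split; apply: eq_bigr => i _; rewrite mulrDr. Qed.

Lemma cauchyM0r f g n : (forall i, (i <= n)%N -> g i = 0) -> cauchyM f g n = 0.
Proof. by move=> g0; apply: big1 => i _; rewrite g0 ?mulr0 // leq_subr. Qed.

Lemma cauchyM1r f n : cauchyM f (fun m => (m == 0%N)%:R) n = f n.
Proof.
rewrite /cauchyM big_ord_recr /= subnn mulr1 big1 ?add0r // => i _.
by rewrite subn_eq0 leqNgt ltn_ord mulr0.
Qed.

Lemma cauchyM_supp f g p q n :
  (forall i, (i < p)%N -> f i = 0) -> (forall i, (i < q)%N -> g i = 0) ->
  (n < p + q)%N -> cauchyM f g n = 0.
Proof.
move=> f0 g0 npq; apply: big1 => i _.
case: (ltnP i p) => ip; first by rewrite f0 ?mul0r.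
by rewrite g0 ?mulr0 //; have := ltn_ord i; lia.
Qed.

(* The Euler operator [y d/dy] acts on the coefficient of [y ^ (2 n - r)]
   as multiplication by [2 n - r]; it is a derivation for the grading by [r]. *)
Definition euler (r : nat) f (n : nat) : A := (2 * n%:R - r%:R) * f n.

Lemma euler_cauchyM r s f g n :
  euler (r + s) (cauchyM f g) n = cauchyM (euler r f) g n + cauchyM f (euler s g) n.
Proof.
rewrite /euler /cauchyM mulr_sumr -big_split; apply: eq_bigr => i _ /=.
rewrite natrB; last by rewrite -ltnS.
by rewrite natrD; ring.
Qed.

Lemma cauchyM1E f n : cauchyM f (fun=> 1) n = \sum_(i < n.+1) f i.
Proof. by apply: eq_bigr => i _; rewrite mulr1. Qed.

(** Taking partial sums is the Cauchy product with the constant sequence [e = 1]; both sides are the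
    product of [f], [g] and two copies of [e]. *)
Lemma sum_cauchyM_partial_sums f g n :
  \sum_(m < n.+1) \sum_(i < m.+1) cauchyM f g i =
  cauchyM (fun m => \sum_(i < m.+1) f i) (fun m => \sum_(i < m.+1) g i) n.
Proof.
pose e : nat -> A := fun=> 1.
transitivity (cauchyM (cauchyM (cauchyM f g) e) e n).
  by rewrite cauchyM1E; apply: eq_bigr => m _; rewrite cauchyM1E.
transitivity (cauchyM (cauchyM f e) (cauchyM g e) n); last first.
  by apply: eq_cauchyM => i _; rewrite cauchyM1E.
rewrite -!cauchyMA; apply: eq_cauchyM => // i _.
by rewrite [RHS]cauchyMCA.
Qed.

End CauchyProduct.

(** * Sums over compositions *)

Section Compositions.
Context {A : pzRingType}.
Implicit Types F G : seq nat -> A.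

(* The compositions are listed in reverse order. *)
Fixpoint comp_sum (r k : nat) F : A :=
  if r is r'.+1 then
    \sum_(1 <= x < k.+1) comp_sum r' (k - x) (fun s => F (x :: s))
  else if k == 0%N then F [::] else 0.

Lemma eq_comp_sum r k F G :
  (forall s, size s = r -> all (leq 1) s -> F s = G s) ->
  comp_sum r k F = comp_sum r k G.
Proof.
elim: r k F G => [|r IH] k F G FG /=; first by rewrite FG.
apply: eq_big_nat => x /andP[x0 _]; apply: IH => s ss sp.
by apply: FG => /=; rewrite ?ss ?x0.
Qed.

Lemma comp_sumD r k F G :
  comp_sum r k (fun s => F s + G s) = comp_sum r k F + comp_sum r k G.
Proof.
elim: r k F G => [|r IH] k F G /=; first by case: ifP => _; rewrite ?addr0.
by rewrite -big_split; apply: eq_bigr => x _; rewrite IH.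
Qed.

Lemma comp_sumZ r k c F :
  comp_sum r k (fun s => c * F s) = c * comp_sum r k F.
Proof.
elim: r k F => [|r IH] k F /=; first by case: ifP => _; rewrite ?mulr0.
by rewrite big_distrr; apply: eq_bigr => x _; rewrite IH.
Qed.

Lemma comp_sum0 r k : comp_sum r k (fun=> 0) = 0.
Proof.
elim: r k => [|r IH] k /=; first by case: ifP.
by apply: big1 => x _.
Qed.

Lemma comp_sum_sum r k I (t : seq I) (F : I -> seq nat -> A) :
  comp_sum r k (fun s => \sum_(i <- t) F i s) =
  \sum_(i <- t) comp_sum r k (F i).
Proof.
elim: t => [|i t IH].
  by rewrite big_nil -[RHS](comp_sum0 r k); apply: eq_comp_sum => s _ _; rewrite big_nil.
rewrite big_cons -IH -comp_sumD; apply: eq_comp_sum => s _ _.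
by rewrite big_cons.
Qed.

Lemma comp_sum_lt r k F : (k < r)%N -> comp_sum r k F = 0.
Proof.
elim: r k F => [|r IH] k F //= kr.
by rewrite big_nat; apply: big1 => x xk; rewrite IH //; lia.
Qed.

(** Splits according to whether the head is 1 or larger; a larger head [x.+1] comes from a
    composition of [k] with head [x]. *)
Lemma comp_sumSS r k F :
  comp_sum r.+1 k.+1 F = comp_sum r k (fun s => F (1%N :: s)) +
    \sum_(1 <= x < k.+1) comp_sum r (k - x) (fun s => F (x.+1 :: s)).
Proof.
rewrite /= big_ltn // subSS subn0; congr (_ + _).
by rewrite big_add1; apply: eq_bigr => x _; rewrite subSS.
Qed.

End Compositions.

(** * The formal identity *)

Section Coefficients.
Context {K : numFieldType}.

(* [alt e] is the coefficient of [y ^ (2 e - 1)] in [- 2 y / (1 + y^2)]. *)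
Definition alt (n : nat) : K := if n == 0%N then 0 else 2 * (-1) ^+ n.

(* [Tcoef s n] gathers the terms of [\bar T (rev s)] with [n_r = n]. *)
Fixpoint Tcoef (s : seq nat) (n : nat) : K :=
  if s is k :: s' then
    ((2 * n%:R - (size s)%:R) ^+ k)^-1 * cauchyM alt (Tcoef s') n
  else (n == 0%N)%:R.

Lemma cauchyM_alt_supp f p n :
  (forall i, (i < p)%N -> f i = 0) -> (n < p.+1)%N -> cauchyM alt f n = 0.
Proof.
move=> f0 np; apply: (@cauchyM_supp _ _ _ 1 p) => //.
by case.
Qed.

Lemma Tcoef_supp s n : (n < size s)%N -> Tcoef s n = 0.
Proof.
elim: s n => [|k s IH] n //= ns.
by rewrite (@cauchyM_alt_supp _ (size s)) ?mulr0.
Qed.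

Lemma weight_neq0 {n r} : (0 < r)%N -> (r <= n)%N -> 2 * n%:R - r%:R != 0 :> K.
Proof.
move=> r0 rn; rewrite subr_eq0 -natrM eqr_nat; lia.
Qed.

Lemma euler_Tcoef1 s n :
  euler (size s).+1 (Tcoef (1%N :: s)) n = cauchyM alt (Tcoef s) n.
Proof.
(* The weight can vanish only below the support, for instance at [2 n = r], and there both sides are
   0. *)
rewrite /euler /= expr1; case: (ltnP n (size s).+1) => ns.
  by rewrite (@cauchyM_alt_supp _ (size s)) ?mulr0 //; apply: Tcoef_supp.
by rewrite mulVKf // weight_neq0.
Qed.

Lemma euler_TcoefSS k s n :
  euler (size s).+1 (Tcoef (k.+2 :: s)) n = Tcoef (k.+1 :: s) n.
Proof.
rewrite /euler; case: (ltnP n (size s).+1) => ns.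
  by rewrite !Tcoef_supp ?mulr0.
rewrite /= [_ ^+ k.+2]exprS invfM -mulrA mulVKf ?weight_neq0 //.
Qed.

Definition Wcoef (k r n : nat) : K := comp_sum r k (fun s => Tcoef s n).

Lemma Wcoef_supp k r n : (n < r)%N -> Wcoef k r n = 0.
Proof.
move=> nr; rewrite -(comp_sum0 r k); apply: eq_comp_sum => s sr _.
by rewrite Tcoef_supp ?sr.
Qed.

Lemma cauchyM_Wcoef f k r n :
  cauchyM f (Wcoef k r) n = comp_sum r k (fun s => cauchyM f (Tcoef s) n).
Proof.
rewrite /cauchyM comp_sum_sum; apply: eq_bigr => i _.
by rewrite comp_sumZ.
Qed.

Lemma euler_Wcoef k r n :
  euler r.+1 (Wcoef k.+1 r.+1) n = cauchyM alt (Wcoef k r) n + Wcoef k r.+1 n.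
Proof.
rewrite /euler /Wcoef comp_sumSS mulrDr; congr (_ + _).
  rewrite -comp_sumZ cauchyM_Wcoef; apply: eq_comp_sum => s sr _.
  by rewrite -euler_Tcoef1 sr.
rewrite mulr_sumr; apply: eq_big_nat => x /andP[x0 _].
rewrite -comp_sumZ; apply: eq_comp_sum => s sr _.
by case: x x0 => // x _; rewrite -sr; exact: euler_TcoefSS.
Qed.

Definition Tones r := Tcoef (nseq r 1%N).

Lemma euler_Tones r n : euler r.+1 (Tones r.+1) n = cauchyM alt (Tones r) n.
Proof. by rewrite -euler_Tcoef1 size_nseq. Qed.

Lemma euler_Tones0 n : euler 0 (Tones 0) n = 0.
Proof. by rewrite /euler /Tones /=; case: n => [|n]; rewrite ?mulr0 //= subrr mul0r. Qed.

(** Coefficients of the right-hand side of the theorem for [r.+1] and [k.+1], with [j] counted from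
    0. *)
Definition shuffle_sum r k n : K :=
  \sum_(j < r.+1) (-1) ^+ j * cauchyM (Tones (r - j)) (Wcoef (k + j.+1) j.+1) n.

Lemma shuffle_sum_supp r k n : (n < r.+1)%N -> shuffle_sum r k n = 0.
Proof.
move=> nr; apply: big1 => j _; rewrite (@cauchyM_supp _ _ _ (r - j) j.+1) ?mulr0 //.
- by move=> i ij; rewrite /Tones Tcoef_supp ?size_nseq.
- by move=> i ij; rewrite Wcoef_supp.
by have := ltn_ord j; lia.
Qed.

(* The terms in which the derivation hits the left factors cancel, after a
   shift of [j], those in which it removes a letter 1 from the right factors. *)
Lemma euler_shuffle_sum r k n :
  euler r.+1 (shuffle_sum r k) n =
    cauchyM alt (cauchyM (Tones r) (Wcoef k 0)) n +
    \sum_(j < r.+1) (-1) ^+ j * cauchyM (Tones (r - j)) (Wcoef (k + j) j.+1) n.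
Proof.
pose Q j := (-1) ^+ j * cauchyM alt (cauchyM (Tones (r - j)) (Wcoef (k + j) j)) n.
pose Q' j := (-1) ^+ j *
  cauchyM (euler (r - j) (Tones (r - j))) (Wcoef (k + j.+1) j.+1) n.
have -> : euler r.+1 (shuffle_sum r k) n = \sum_(j < r.+1) Q' j + \sum_(j < r.+1) Q j +
    \sum_(j < r.+1) (-1) ^+ j * cauchyM (Tones (r - j)) (Wcoef (k + j) j.+1) n.
  rewrite /euler /shuffle_sum mulr_sumr -!big_split; apply: eq_bigr => j _ /=.
  rewrite mulrCA.
  (* The grading is split between the two factors so that the Leibniz rule applies. *)
  have -> : r.+1%:R = ((r - j) + j.+1)%:R :> K.
    by congr (_%:R); have := ltn_ord j; lia.
  rewrite -/(euler _ (cauchyM _ _) n) euler_cauchyM mulrDr -addrA -/(Q' j).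
  congr (_ + _); rewrite -mulrDr; congr (_ * _).
  rewrite cauchyMCA -cauchyMDr; apply: eq_cauchyM => // i _.
  by rewrite addnS euler_Wcoef.
congr (_ + _); rewrite [X in X + _]big_ord_recr [X in _ + X]big_ord_recl /=.
(* For [j = r] the left factor is the constant series 1, which the Euler operator kills. *)
have -> : Q' r = 0.
  by rewrite /Q' subnn cauchyMC cauchyM0r ?mulr0 // => i _; rewrite euler_Tones0.
rewrite addr0 addrCA -big_split big1 ?addr0 /=.
  by rewrite /Q expr0 mul1r subn0 addn0.
move=> j _; rewrite /Q /Q' /bump /= add1n exprS mulN1r mulNr.
apply/eqP; rewrite subr_eq0; apply/eqP; congr (_ * _).
have -> : (r - j = (r - j.+1).+1)%N by have := ltn_ord j; lia.
by rewrite cauchyMA; apply: eq_cauchyM => // i _; rewrite euler_Tones.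
Qed.

(** Both sides vanish for [n <= r]. For larger [n] the weight is nonzero, so it suffices to compare
    them after the Euler operator, by induction on [k]. *)
Lemma Tcoef_formula r k n : Tcoef (k.+1 :: nseq r 1%N) n = shuffle_sum r k n.
Proof.
elim: k n => [|k IH] n; (case: (ltnP n r.+1) => nr;
    first by rewrite shuffle_sum_supp ?Tcoef_supp //= size_nseq);
  apply: (mulfI (weight_neq0 (ltn0Sn r) nr)).
- rewrite -[LHS]/(euler r.+1 (Tones r.+1) n) -[RHS]/(euler r.+1 (shuffle_sum r 0) n).
  rewrite euler_Tones euler_shuffle_sum [X in _ + X]big1 ?addr0.
    (* [Wcoef 0 0] is the unit of the Cauchy product; the other sum vanishes because [j] has no
       composition into [j.+1] parts. *)
    by apply: eq_cauchyM => // i _; rewrite -[LHS]cauchyM1r.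
  move=> j _; rewrite cauchyM0r ?mulr0 // => i _.
  by rewrite /Wcoef comp_sum_lt.
- rewrite -[RHS]/(euler r.+1 (shuffle_sum r k.+1) n) euler_shuffle_sum.
  rewrite cauchyM0r => [|i _]; last by rewrite cauchyM0r.
  have := euler_TcoefSS k (nseq r 1%N) n; rewrite size_nseq => Ek.
  rewrite add0r [LHS]Ek IH.
  by apply: eq_bigr => j _; rewrite addnS.
Qed.

End Coefficients.

(** * Multiple sums over tuples *)

Lemma big_tuple_rcons (V : nmodType) r M (F : seq nat -> V) :
  \sum_(t : r.+1.-tuple 'I_M) F (map val t) =
  \sum_(t : r.-tuple 'I_M) \sum_(x < M) F (rcons (map val t) x).
Proof.
rewrite pair_big (reindex (fun p : r.-tuple 'I_M * 'I_M => [tuple of rcons p.1 p.2])) /=.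
  by apply: eq_bigr => p _; rewrite map_rcons.
apply: onW_bij; apply: inj_card_bij.
  move=> [t x] [t' x'] /(congr1 val) /= /rcons_inj[tt' xx'].
  by congr (_, _) => //; apply: val_inj.
by rewrite card_prod !card_tuple card_ord expnS mulnC.
Qed.

(** Since [k < M], every part of a composition of [k] fits in ['I_M]. The induction peels off the
    last entry, which is the head of the reversed list. *)
Lemma comp_sum_tuple (V : pzRingType) r k M (F : seq nat -> V) : (k < M)%N ->
  \sum_(t : r.-tuple 'I_M | all (leq 1) (map val t) && (sumn (map val t) == k))
    F (map val t) = comp_sum r k (fun s => F (rev s)).
Proof.
elim: r k F => [|r IH] k F kM.
  rewrite big_mkcond (big_pred1 [tuple]) /=; last by move=> t; rewrite [t]tuple0 /= eqxx.
  by rewrite eq_sym.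
rewrite big_mkcond (big_tuple_rcons _ _ _ (fun s =>
  if all (leq 1) s && (sumn s == k) then F s else 0)) exchange_big /=.
pose G x := \sum_(t : r.-tuple 'I_M) if all (leq 1) (rcons (map val t) x) &&
  (sumn (rcons (map val t) x) == k) then F (rcons (map val t) x) else 0.
have sE t x : all (leq 1) (rcons t x) && (sumn (rcons t x) == k) =
    [&& (0 < x)%N, (x <= k)%N & all (leq 1) t && (sumn t == k - x)%N].
  rewrite all_rcons sumn_rcons; case: (0 < x)%N => //=.
  by case: (all _ t); lia.
rewrite -(big_mkord xpredT G) (@big_cat_nat _ _ _ k.+1) //= [X in _ + X]big_nat.
rewrite [X in _ + X]big1 ?addr0; last first.
  move=> x /andP[kx _]; apply: big1 => t _.
  by rewrite sE (leqNgt x k) kx andbF.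
rewrite big_ltn // {1}/G big1 ?add0r; last by move=> t _; rewrite sE.
apply: eq_big_nat => x /andP[x0 xk].
rewrite (@eq_comp_sum _ _ _ _ (fun s => F (rcons (rev s) x))); last first.
  by move=> s _ _; rewrite rev_cons.
rewrite -(IH _ (fun s => F (rcons s x))); last by lia.
rewrite [RHS]big_mkcond; apply: eq_bigr => t _.
by rewrite sE x0 -ltnS xk.
Qed.

Section Partial.
Context {K : numFieldType}.

Definition Tterm (ks t : seq nat) : K :=
  2 ^+ size ks * (-1) ^+ last 0%N t *
  \prod_(i < size ks) ((2 * (nth 0%N t i)%:R - i.+1%:R) ^+ nth 0%N ks i)^-1.

Lemma Tterm_rcons ks k t n : size t = size ks -> (last 0 t < n)%N ->
  Tterm (rcons ks k) (rcons t n) =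
  ((2 * n%:R - (size ks).+1%:R) ^+ k)^-1 *
    (Tterm ks t * alt (n - last 0%N t)).
Proof.
move=> st tn; rewrite /Tterm size_rcons last_rcons big_ord_recr /=.
rewrite !nth_rcons st ltnn eqxx /alt subn_eq0 leqNgt tn /= exprS.
have -> : (-1) ^+ n = (-1) ^+ last 0%N t * (-1) ^+ (n - last 0%N t) :> K.
  by rewrite -exprD subnKC // ltnW.
under eq_bigr => i _ do rewrite !nth_rcons st ltn_ord.
by ring.
Qed.

(** [path ltn 0] encodes positivity and strict increase at once; the default of [last] puts the
    empty tuple in slice 0. *)
Definition Tslice (ks : seq nat) (n : nat) (t : seq nat) : K :=
  if path ltn 0%N t && (last 0%N t == n) then Tterm ks t else 0.

(** Links the recursive coefficients to the nested sums: removing the last index [n] leaves a tuple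
    ending at some [i], and [alt (n - i)] supplies the factor 2 and the change of sign. *)
Lemma sum_Tslice ks M n : (n < M)%N ->
  \sum_(t : (size ks).-tuple 'I_M) Tslice ks n (map val t) = Tcoef (rev ks) n.
Proof.
elim/last_ind: ks n => [|ks k IH] n nM.
  rewrite (big_pred1 [tuple]) /=; last by move=> t; rewrite [t]tuple0 /= eqxx.
  by rewrite /Tslice /Tterm /= big_ord0 !mulr1 eq_sym; case: eqP.
rewrite size_rcons big_tuple_rcons.
rewrite rev_rcons /=.
rewrite size_rev cauchyMC mulr_sumr.
under [RHS]eq_bigr => i _.
  rewrite -IH; last by have := ltn_ord i; lia.
  rewrite mulr_suml mulr_sumr; over.
rewrite [RHS]exchange_big; apply: eq_bigr => t _ /=.
have st : size (map val t) = size ks by rewrite size_map size_tuple.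
set s := map val t in st *.
rewrite (bigD1 (Ordinal nM)) //= [X in _ + X]big1 ?addr0; last first.
  move=> x; rewrite /Tslice last_rcons -val_eqE /= => /negbTE ->.
  by rewrite andbF.
rewrite {1}/Tslice rcons_path last_rcons eqxx andbT /=.
(* Without a strict increase the left side is 0, and on the right [alt 0 = 0] kills the only
   possible term [i = n]. *)
case: (ltnP (last 0%N s) n) => sn; last first.
  rewrite andbF big1 // => i _; rewrite /Tslice.
  case: eqP => si; rewrite ?andbF ?mul0r ?mulr0 //.
  have -> : (n - i)%N = 0%N by lia.
  by rewrite /alt eqxx !mulr0.
rewrite andbT (bigD1 (Ordinal (ltnW sn : (last 0%N s < n.+1)%N))) //=.
rewrite [X in _ + X]big1 ?addr0; last first.
  move=> i; rewrite /Tslice -val_eqE /= eq_sym => /negbTE ->.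
  by rewrite andbF mul0r mulr0.
rewrite /Tslice eqxx andbT; case: ifP => _; last by rewrite mul0r mulr0.
by rewrite Tterm_rcons.
Qed.

End Partial.

Section PartialReal.
Context {R : realType}.

Lemma Tbar_partE ks N : Tbar_part R ks N = \sum_(n < N.+1) Tcoef (rev ks) n.
Proof.
under eq_bigr => n _ do rewrite -(@sum_Tslice _ _ N.+1) //.
rewrite exchange_big /Tbar_part /= big_mkcond; apply: eq_bigr => t _.
have -> : sorted ltn (map val t) && all (fun m => 0 < m)%N (map val t) =
    path ltn 0%N (map val t).
  by rewrite path_sortedE; [rewrite andbC | exact: ltn_trans].
have lN : (last 0%N (map val t) < N.+1)%N.
  have : all (fun i => i < N.+1)%N (map val t).
    by apply/allP => i /mapP[j _ ->]; exact: ltn_ord.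
  elim/last_ind: (map val t) => //= s x _.
  by rewrite last_rcons all_rcons => /andP[].
rewrite /Tslice; case: ifP => _ /=; last by rewrite big1.
rewrite (bigD1 (Ordinal lN)) //= eqxx [X in _ + X]big1 ?addr0 // => i.
by rewrite -val_eqE /= eq_sym => /negbTE ->.
Qed.

Lemma W_comp_sum k r : W R k r = comp_sum r k (fun s => Tbar R (rev s)).
Proof. exact: (comp_sum_tuple _ r k k.+1 (Tbar R) (ltnSn k)). Qed.

End PartialReal.

(** * Cesaro means of Cauchy products *)

Section Cesaro.
Context {R : realType}.
Local Open Scope classical_set_scope.

(** Write [u = (u - a) + a]. The first part is dominated by a bound on [v] times the means of
    [|u - a|], which tend to 0; the second gives [a] times the means of [v]. *)
Lemma cauchyM_mean_cvg (u v : R^nat) (a b : R) :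
  u @ \oo --> a -> v @ \oo --> b ->
  (fun n => n.+1%:R^-1 * cauchyM u v n) @ \oo --> a * b.
Proof.
move=> ua vb.
have meanv : (fun n => n.+1%:R^-1 * \sum_(i < n.+1) v i) @ \oo --> b.
  under eq_fun => n do rewrite -(big_mkord xpredT v).
  exact: cesaro vb.
have [M [_ vM]] : bounded_fun v by apply/cvg_seq_bounded/cvgP/vb.
pose C := `|M| + 1.
have vC n : `|v n| <= C.
  by apply: (vM C) => //; rewrite /C; have := ler_norm M; lra.
have meanu : (fun n => n.+1%:R^-1 * \sum_(i < n.+1) `|u i - a|) @ \oo --> 0.
  under eq_fun => n do rewrite -(big_mkord xpredT (fun i => `|u i - a|)).
  apply: (@cesaro R (fun i => `|u i - a|)).
  by apply/norm_cvg0P; rewrite -(subrr a); apply: cvgB => //; exact: cvg_cst.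
have small : (fun n => n.+1%:R^-1 * cauchyM (fun i => u i - a) v n) @ \oo --> 0.
  apply: norm_cvg0.
  apply: (@squeeze_cvgr _ _ _ _ (fun=> 0)
    (fun n => C * (n.+1%:R^-1 * \sum_(i < n.+1) `|u i - a|))).
  - apply: nearW => n; rewrite normr_ge0 /= normrM ger0_norm ?invr_ge0 //.
    rewrite mulrCA ler_wpM2l ?invr_ge0 // mulr_sumr.
    apply: le_trans (ler_norm_sum _ _ _) _; apply: ler_sum => i _.
    by rewrite normrM mulrC ler_wpM2r.
  - exact: cvg_cst.
  - by rewrite -[X in _ --> X](mulr0 C); exact: cvgMl_tmp.
suff : (fun n => n.+1%:R^-1 * cauchyM (fun i => u i - a) v n +
    a * (n.+1%:R^-1 * \sum_(i < n.+1) v i)) @ \oo --> a * b.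
  apply: cvg_trans; apply: near_eq_cvg; apply: nearW => n.
  rewrite mulrCA -mulrDr; congr (_ * _).
  rewrite (reindex_inj rev_ord_inj) /= mulr_sumr -big_split.
  by apply: eq_bigr => i _; rewrite /= subSS; ring.
rewrite -[a * b]add0r; apply: cvgD => //.
exact: cvgMl_tmp.
Qed.

(** Summing the partial sums of a Cauchy product gives the Cauchy product of the partial sums, so
    the previous lemma applies. *)
Lemma cesaro_cauchyM (f g : R^nat) (a b : R) :
  (fun n => \sum_(i < n.+1) f i) @ \oo --> a ->
  (fun n => \sum_(i < n.+1) g i) @ \oo --> b ->
  arithmetic_mean (fun n => \sum_(i < n.+1) cauchyM f g i) @ \oo --> a * b.
Proof.
move=> fa gb; have := cauchyM_mean_cvg _ _ _ _ fa gb.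
apply: cvg_trans; apply: near_eq_cvg; apply: nearW => n.
by rewrite -sum_cauchyM_partial_sums /arithmetic_mean /series /= big_mkord.
Qed.

End Cesaro.

(** * Convergence *)

Section Convergence.
Context {R : realType}.
Local Open Scope classical_set_scope.

(** Summation by parts: twice the partial sum is a partial sum of the absolutely convergent series
    [U] plus boundary terms. *)
Lemma cvg_alternating_bv (b : R^nat) :
  b @ \oo --> 0 -> cvgn (series (fun n => `|b n - b n.+1|)) ->
  cvgn (series (fun n => (-1) ^+ n * b n)).
Proof.
move=> b0 bv.
pose U := series (fun n => (-1) ^+ n * (b n - b n.+1)).
have cU : cvgn U.
  apply: normed_cvg; apply: series_le_cvg bv => n //=.
  by rewrite normrM normrX normrN1 expr1n mul1r.
have SE n : series (fun n => (-1) ^+ n * b n) n =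
    2^-1 * (U n - (-1) ^+ n * b n + b 0%N).
  rewrite /U /series /=; elim: n => [|n IH].
    by rewrite !big_geq // expr0; ring.
  by rewrite !big_nat_recr //= IH exprS; field.
have -> : series (fun n => (-1) ^+ n * b n) =
    (fun n => 2^-1 * (U n - (-1) ^+ n * b n + b 0%N)).
  by apply/funext => n; exact: SE.
have sb : (fun n => (-1) ^+ n * b n) @ \oo --> 0.
  apply: norm_cvg0; have : (fun n => `|b n|) @ \oo --> 0 by apply/norm_cvg0P.
  apply: cvg_trans; apply: near_eq_cvg; apply: nearW => n.
  by rewrite normrM normrX normrN1 expr1n mul1r.
apply: (cvgP (2^-1 * (limn U - 0 + b 0%N))); apply: cvgMl_tmp.
by apply: cvgD; [exact: cvgB | exact: cvg_cst].
Qed.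

(** * Telescoping estimates with square roots *)

Definition sqrtn n : R := Num.sqrt n%:R.

Lemma sqrtn_ge0 n : 0 <= sqrtn n. Proof. exact: sqrtr_ge0. Qed.

Lemma sqrtn_sqr n : sqrtn n * sqrtn n = n%:R.
Proof. by rewrite -expr2 sqr_sqrtr. Qed.

Lemma sqrtnS_gt0 n : 0 < sqrtn n.+1. Proof. by rewrite sqrtr_gt0. Qed.

Lemma sqrtn_leS n : sqrtn n <= sqrtn n.+1.
Proof. by rewrite ler_wsqrtr // ler_nat. Qed.

Lemma invsqrtnS_cvg0 : (fun n => (sqrtn n.+1)^-1) @ \oo --> 0.
Proof.
have -> : (fun n => (sqrtn n.+1)^-1) = (fun n => Num.sqrt (harmonic n)).
  by apply/funext => n; rewrite /harmonic /= sqrtrV.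
by rewrite -sqrtr0; apply: continuous_cvg; [exact: sqrt_continuous|exact: cvg_harmonic].
Qed.

(** The difference of the roots is the inverse of their sum, which is at most [2 * sqrtn n.+1]. *)
Lemma invsqrtnS_le_diff n : (sqrtn n.+1)^-1 <= 2 * (sqrtn n.+1 - sqrtn n).
Proof.
have h := sqrtn_leS n; have p := sqrtnS_gt0 n; have q := sqrtn_ge0 n.
have e := sqrtn_sqr n; have e' := sqrtn_sqr n.+1.
rewrite -[n.+1%:R]natr1 in e'.
rewrite -(ler_pM2l p) mulfV ?gt_eqF //; nra.
Qed.

Lemma sum_invsqrtnS_le n : \sum_(i < n) (sqrtn i.+1)^-1 <= 2 * sqrtn n.
Proof.
elim: n => [|n IH]; first by rewrite big_ord0 mulr_ge0 ?sqrtn_ge0.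
by rewrite big_ord_recr /=; have := invsqrtnS_le_diff n; lra.
Qed.

Lemma sum_invsqrtnS_bound c (f : nat -> R) n : 0 <= c ->
  (forall i, 0 <= f i <= c * (sqrtn i.+1)^-1) ->
  0 <= \sum_(i < n) f i <= c * (2 * sqrtn n.+1).
Proof.
move=> c0 fc; rewrite sumr_ge0 /=; last by move=> i _; have /andP[] := fc i.
apply: (@le_trans _ _ (c * (2 * sqrtn n))).
  apply: le_trans (ler_wpM2l c0 (sum_invsqrtnS_le n)).
  by rewrite mulr_sumr; apply: ler_sum => i _; have /andP[] := fc i.
by rewrite ler_wpM2l // ler_wpM2l // sqrtn_leS.
Qed.

Lemma invsqrtnS3_le_diff n :
  (sqrtn n.+1 ^+ 3)^-1 <= 4 * ((sqrtn n.+1)^-1 - (sqrtn n.+2)^-1).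
Proof.
have p := sqrtnS_gt0 n; have p' := sqrtnS_gt0 n.+1; have h := sqrtn_leS n.+1.
have e := sqrtn_sqr n.+1; have e' := sqrtn_sqr n.+2.
have n1 : 1 <= sqrtn n.+1 by rewrite -[1]sqrtr1 ler_wsqrtr // ler1n.
rewrite -[n.+2%:R]natr1 -e in e'.
set x := sqrtn n.+1 in p h n1 e' *; set y := sqrtn n.+2 in p' h e' *.
(* From [y^2 = x^2 + 1 <= 2 x^2]. Hence [y (x + y) <= 15/4 x^2], which the constant 4 absorbs. *)
have yx : y <= 3 / 2 * x by nra.
have -> : x^-1 - y^-1 = (x * y * (x + y))^-1.
  have xy0 : x + y != 0 by rewrite gt_eqF // addr_gt0.
  rewrite -[RHS]mul1r (_ : 1 = y * y - x * x); last by rewrite e'; ring.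
  by field; rewrite xy0 !gt_eqF.
rewrite -[leRHS]invrK lef_pV2 ?posrE ?exprn_gt0 ?invr_gt0 ?mulr_gt0 ?invr_gt0
  ?mulr_gt0 ?addr_gt0 //.
rewrite invfM invrK exprS expr2.
have : y * (x + y) <= 15 / 4 * (x * x) by nra.
by nra.
Qed.

Lemma cvg_series_invsqrtnS3 : cvgn (series (fun n => (sqrtn n.+1 ^+ 3)^-1)).
Proof.
apply: nondecreasing_is_cvgn.
  apply: nondecreasing_series => n _ _.
  by rewrite invr_ge0 exprn_ge0 ?sqrtn_ge0.
exists (4 * (sqrtn 1)^-1) => _ [n _ <-].
suff : series (fun n => (sqrtn n.+1 ^+ 3)^-1) n <=
    4 * ((sqrtn 1)^-1 - (sqrtn n.+1)^-1).
  by move/le_trans; apply; rewrite ler_pM2l // gerBl invr_ge0 sqrtn_ge0.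
rewrite /series /=; elim: n => [|n IH]; first by rewrite big_geq // subrr mulr0.
by rewrite big_nat_recr //=; have := invsqrtnS3_le_diff n; lra.
Qed.

(** * Size and variation of the terms *)

(* The signs of [Tcoef s n] alternate with [n], so [Tabs s n] is its absolute value. *)
Definition Tabs s n : R := (-1) ^+ n * Tcoef s n.

(** The signs of [n], [i] and [alt (n - i)] cancel, so the product with [alt] becomes twice a plain
    partial sum. *)
Lemma Tabs_cons k s n :
  Tabs (k :: s) n =
  ((2 * n%:R - (size s).+1%:R) ^+ k)^-1 * (2 * \sum_(i < n) Tabs s i).
Proof.
rewrite /Tabs /= mulrCA; congr (_ * _); rewrite cauchyMC /cauchyM.
rewrite big_ord_recr /= subnn /alt eqxx mulr0 addr0 !mulr_sumr.
apply: eq_bigr => i _; rewrite subn_eq0 leqNgt ltn_ord /=.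
have -> : (-1) ^+ n = (-1) ^+ i * (-1) ^+ (n - i) :> R.
  by rewrite -exprD subnKC // ltnW.
have e : (-1) ^+ (n - i) * (-1) ^+ (n - i) = 1 :> R by rewrite -expr2 sqrr_sign.
by rewrite -[RHS]mulr1 -[X in _ = _ * X]e; ring.
Qed.

Lemma Tabs_supp s n : (n < size s)%N -> Tabs s n = 0.
Proof. by move=> ns; rewrite /Tabs Tcoef_supp ?mulr0. Qed.

Lemma weight_ge n r : (r <= n)%N -> n%:R <= 2 * n%:R - r%:R :> R.
Proof. by rewrite -(ler_nat R) => rn; lra. Qed.

Lemma inv_weightX_bound m k r n : (0 < r <= n)%N -> (m <= k)%N ->
  0 <= ((2 * n%:R - r%:R : R) ^+ k)^-1 <= (n%:R ^+ m)^-1.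
Proof.
move=> /andP[r0 rn] mk.
have n1 : 1 <= n%:R :> R by rewrite ler1n (leq_trans r0 rn).
have wn := @weight_ge _ _ rn; have w1 := le_trans n1 wn.
rewrite invr_ge0 exprn_ge0 ?(le_trans ler01 w1) //=.
rewrite lef_pV2 ?posrE ?exprn_gt0 ?(lt_le_trans ltr01) //.
apply: le_trans (ler_weXn2l w1 mk).
by rewrite lerXn2r ?nnegrE ?(le_trans ler01).
Qed.

Lemma invr_nat_le n : (0 < n)%N -> n%:R^-1 <= 2 * (sqrtn n.+1 * sqrtn n.+1)^-1 :> R.
Proof.
move=> n0; have n1 : 1 <= n%:R :> R by rewrite ler1n.
rewrite sqrtn_sqr -[2]invrK -invfM lef_pV2 ?posrE ?mulr_gt0 ?invr_gt0 ?ltr0n //.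
by rewrite -[n.+1%:R]natr1; lra.
Qed.

(** The bound reproduces itself: the inner sum costs [2 * sqrtn n.+1], the recursion a factor 2, and
    the weight at most [1/n <= 2/(n+1)], whence 8 per letter. *)
Lemma Tabs_bound s n : all (leq 1) s ->
  0 <= Tabs s n <= 8 ^+ size s * (sqrtn n.+1)^-1.
Proof.
elim: s n => [|k s IH] n.
  move=> _; rewrite /Tabs /= expr0 mul1r; case: n => [|n] /=.
    by rewrite expr0 mulr1 ler01 /sqrtn sqrtr1 invr1 lexx.
  by rewrite mulr0 lexx invr_ge0 sqrtn_ge0.
move=> /= /andP[k0 sp].
have p := sqrtnS_gt0 n.
case: (ltnP n (size s).+1) => ns.
  by rewrite Tabs_supp // lexx mulr_ge0 ?exprn_ge0 // invr_ge0 ltW.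
have n0 : (0 < n)%N by case: n ns {p}.
rewrite Tabs_cons.
have /andP[d0 d1] := @inv_weightX_bound 1 k (size s).+1 n ns k0.
have := le_trans d1 (invr_nat_le _ n0).
set d := (_ ^+ k)^-1 in d0 d1 *; move=> d2.
have /andP[B0 B1] := sum_invsqrtnS_bound (8 ^+ size s) (Tabs s) n
  (exprn_ge0 _ (ler0n R 8)) (fun i => IH i sp).
rewrite mulr_ge0 ?mulr_ge0 //=.
apply: le_trans (ler_pM d0 _ d2 (ler_wpM2l _ B1)) _ => //; first exact: mulr_ge0.
rewrite exprS le_eqVlt; apply/orP; left; apply/eqP.
by field; rewrite gt_eqF.
Qed.

Lemma inv_weightX_variation k r n : (0 < r <= n)%N -> (0 < k)%N ->
  `|((2 * n%:R - r%:R) ^+ k)^-1 - ((2 * n.+1%:R - r%:R) ^+ k)^-1|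
    <= 2 * (n%:R ^+ 2)^-1 :> R.
Proof.
move=> rn; have /andP[r0 rn'] := rn.
have n1 : 1 <= n%:R :> R by rewrite ler1n (leq_trans r0 rn').
have n0 : 0 < n%:R :> R by exact: lt_le_trans ltr01 n1.
have n2 : 0 < (n%:R ^+ 2)^-1 :> R by rewrite invr_gt0 exprn_gt0.
case: k => [|[|k]] // _.
- rewrite !expr1 -[n.+1%:R]natr1; have wn := @weight_ge _ _ rn'.
  set c := _ - r%:R in wn *.
  rewrite (_ : _ - r%:R = c + 2); last by rewrite /c; ring.
  have c0 : 0 < c by lra.
  have c2 : 0 < c + 2 by lra.
  have -> : c^-1 - (c + 2)^-1 = 2 * (c * (c + 2))^-1 by field; rewrite !gt_eqF.
  have pc : 0 < 2 * (c * (c + 2))^-1 by rewrite mulr_gt0 ?invr_gt0 ?mulr_gt0.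
  rewrite (gtr0_norm pc).
  rewrite ler_pM2l // lef_pV2 ?posrE ?mulr_gt0 ?exprn_gt0 //.
  by rewrite expr2; nra.
(* For exponents at least 2 both inverses already lie between 0 and [1/n^2]. *)
- have /andP[a0 a1] := @inv_weightX_bound 2 k.+2 r n rn isT.
  have rn1 : (0 < r <= n.+1)%N by rewrite r0 leqW.
  have /andP[b0 b1] := @inv_weightX_bound 2 k.+2 r n.+1 rn1 isT.
  have {}b1 := le_trans b1 _.
  have : (n.+1%:R ^+ 2)^-1 <= (n%:R ^+ 2)^-1 :> R.
    rewrite lef_pV2 ?posrE ?exprn_gt0 //.
    by rewrite lerXn2r ?nnegrE // ler_nat.
  move/b1; move: n2 a0 a1 b0 {b1}; move: ((n%:R ^+ 2)^-1) => p.
  move: ((_ ^+ k.+2)^-1) ((_ ^+ k.+2)^-1) => a b *.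
  by rewrite ler_norml; apply/andP; split; lra.
Qed.

(** The change splits into [2 (d - d') B], from the weight, and [2 d' Tabs s n], from the new
    summand. They contribute [2 * 16] and [2 * 1] to the constant 34. *)
Lemma Tabs_variation k s n : all (leq 1) (k :: s) ->
  `|Tabs (k :: s) n - Tabs (k :: s) n.+1| <=
  34 * 8 ^+ size s * (sqrtn n.+1 ^+ 3)^-1.
Proof.
move=> /= /andP[k0 sp]; rewrite !Tabs_cons big_ord_recr /=.
have p := sqrtnS_gt0 n.
have /andP[B0 B1] := sum_invsqrtnS_bound (8 ^+ size s) (Tabs s) n
  (exprn_ge0 _ (ler0n R 8)) (fun i => Tabs_bound s i sp).
have /andP[T0 T1] := Tabs_bound s n sp.
have e0 : 0 < 8 ^+ size s :> R by rewrite exprn_gt0.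
set d := (_ ^+ k)^-1; set d' := (_ ^+ k)^-1; set B := \sum_(i < n) _ in B0 B1 *.
have -> : d * (2 * B) - d' * (2 * (B + Tabs s n)) =
  2 * ((d - d') * B) - 2 * (d' * Tabs s n) by ring.
have x3 : (sqrtn n.+1 ^+ 3)^-1 = (sqrtn n.+1 * sqrtn n.+1)^-1 * (sqrtn n.+1)^-1 :> R.
  by rewrite -invfM exprS expr2 mulrA mulrC.
have H1 : `|(d - d') * B| <= 16 * 8 ^+ size s * (sqrtn n.+1 ^+ 3)^-1.
  case: (ltnP n (size s).+1) => ns.
    have -> : B = 0.
      apply: big1 => i _; rewrite Tabs_supp //.
      exact: leq_trans (ltn_ord i) ns.
    by rewrite mulr0 normr0 !mulr_ge0 ?ltW // invr_gt0 exprn_gt0.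
  have n0 : (0 < n)%N by apply: leq_trans ns.
  have V := @inv_weightX_variation k (size s).+1 n ns k0.
  have N0 := invr_nat_le _ n0.
  have ni : 0 <= n%:R^-1 :> R by rewrite invr_ge0.
  have {}V : `|d - d'| <=
      8 * ((sqrtn n.+1 * sqrtn n.+1)^-1 * (sqrtn n.+1 * sqrtn n.+1)^-1).
    apply: le_trans V _; rewrite -exprVn expr2.
    have := ler_pM ni ni N0 N0; lra.
  rewrite normrM (ger0_norm B0).
  apply: le_trans (ler_pM _ _ V B1) _ => //.
  rewrite le_eqVlt; apply/orP; left; apply/eqP.
  by field; rewrite gt_eqF.
have H2 : `|d' * Tabs s n| <= 8 ^+ size s * (sqrtn n.+1 ^+ 3)^-1.
  case: (ltnP n (size s)) => ns.
    by rewrite Tabs_supp // mulr0 normr0 !mulr_ge0 ?ltW // invr_gt0 exprn_gt0.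
  have /andP[d0 d1] := @inv_weightX_bound 1 k (size s).+1 n.+1 ns k0.
  rewrite expr1 -[X in _ <= X^-1]sqrtn_sqr in d1.
  rewrite (ger0_norm (mulr_ge0 d0 T0)).
  apply: le_trans (ler_pM d0 T0 d1 T1) _.
  by rewrite x3 mulrCA.
apply: (le_trans (ler_normB _ _)).
rewrite ![`|2 * _|]normrM (ger0_norm (ler0n R 2)) -!mulrA in H1 *.
by move: (8 ^+ size s * _) H1 H2 => z; lra.
Qed.

(** * Limits of the partial sums *)

Lemma Tcoef_series_cvg s : all (leq 1) s ->
  cvgn (fun N => \sum_(n < N.+1) Tcoef s n : R).
Proof.
case: s => [|k s] sp.
  rewrite (_ : (fun N => _) = (fun=> 1)); first exact: is_cvg_cst.
  apply/funext => N; rewrite big_ord_recl /= big1 ?addr0 //.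
have : cvgn (series (fun n => (-1) ^+ n * Tabs (k :: s) n)).
  apply: cvg_alternating_bv.
    apply: (@squeeze_cvgr _ _ _ _ (fun=> 0)
      (fun n => 8 ^+ size (k :: s) * (sqrtn n.+1)^-1)).
    - by apply: nearW => n; exact: Tabs_bound.
    - exact: cvg_cst.
    - rewrite -[X in _ --> X](mulr0 (8 ^+ size (k :: s))).
      by apply: cvgMl_tmp; exact: invsqrtnS_cvg0.
  apply: (@series_le_cvg _ _ (fun n => 34 * 8 ^+ size s * (sqrtn n.+1 ^+ 3)^-1)).
  - by move=> n; exact: normr_ge0.
  - by move=> n; rewrite !mulr_ge0 ?exprn_ge0 // invr_ge0 exprn_ge0 ?sqrtn_ge0.
  - by move=> n; exact: Tabs_variation.
  - by apply: is_cvg_seriesZ; exact: cvg_series_invsqrtnS3.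
move=> /cvg_ex[l cl]; apply: (cvgP l).
move: cl; rewrite -cvg_shiftS; apply: cvg_trans; apply: near_eq_cvg; apply: nearW => N.
rewrite /series /= big_mkord; apply: eq_bigr => n _.
by rewrite /Tabs mulrA -expr2 sqrr_sign mul1r.
Qed.

Lemma Tbar_cvg s : all (leq 1) s ->
  (fun N => \sum_(n < N.+1) Tcoef s n) @ \oo --> Tbar R (rev s).
Proof.
move=> sp; have -> : Tbar R (rev s) = limn (fun N => \sum_(n < N.+1) Tcoef s n).
  by congr (limn _); apply/funext => N; rewrite Tbar_partE revK.
exact: Tcoef_series_cvg.
Qed.

Lemma comp_sum_cvg r k (F : nat -> seq nat -> R) (G : seq nat -> R) :
  (forall s, size s = r -> all (leq 1) s -> F ^~ s @ \oo --> G s) ->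
  (fun N => comp_sum r k (F N)) @ \oo --> comp_sum r k G.
Proof.
elim: r k F G => [|r IH] k F G FG /=.
  by case: ifP => _; [exact: FG | exact: cvg_cst].
under eq_fun => N do rewrite big_nat.
rewrite big_nat; apply: cvg_big => [|x /andP[x0 _]]; first exact: add_continuous.
apply: IH => s sr sp; apply: FG => /=; first by rewrite sr.
by rewrite x0.
Qed.

Lemma W_cvg k r :
  (fun N => \sum_(n < N.+1) Wcoef k r n) @ \oo --> W R k r.
Proof.
rewrite W_comp_sum.
have : (fun N => comp_sum r k (fun s => \sum_(n < N.+1) Tcoef s n)) @ \oo -->
    comp_sum r k (fun s => Tbar R (rev s)).
  by apply: comp_sum_cvg => s _ sp; exact: Tbar_cvg.
apply: cvg_trans; apply: near_eq_cvg; apply: nearW => N.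
by rewrite comp_sum_sum.
Qed.

End Convergence.

(** * From coefficients to values *)

Theorem mainTheorem6 (R : realType) (r k : nat) :
  (0 < r)%N -> (0 < k)%N ->
  Tbar R (rcons (nseq r.-1 1%N) k) =
  \sum_(1 <= j < r.+1)
     (-1) ^+ (j.-1) * Tbar R (nseq (r - j) 1%N) * W R (k + j - 1) j.
Proof.
case: r => // r; case: k => // k _ _ /=.
pose S (f : nat -> R) N := \sum_(n < N.+1) f n.
have ones m : all (leq 1) (nseq m 1%N) by elim: m.
have lhs_cvg : (S (Tcoef (k.+1 :: nseq r 1%N)) @ \oo -->
    Tbar R (rcons (nseq r 1%N) k.+1))%classic.
  by rewrite -(rev_nseq r 1%N) -rev_cons rev_nseq; apply: Tbar_cvg => /=.
(* The left side converges, so it is also the limit of its Cesaro means; these are shown to tend to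
   the right side. *)
have := cesaro lhs_cvg; move/cvg_lim => <- //; apply/cvg_lim => //.
rewrite big_add1 big_mkord.
have : ((fun N => \sum_(j < r.+1) (-1) ^+ j * arithmetic_mean
     (S (cauchyM (Tones (r - j)) (Wcoef (k + j.+1) j.+1))) N) @ \oo -->
   \sum_(j < r.+1) (-1) ^+ j *
     (Tbar R (nseq (r - j) 1%N) * W R (k + j.+1) j.+1))%classic.
  apply: cvg_big => [|j _]; first exact: add_continuous.
  apply: cvgMl_tmp; apply: cesaro_cauchyM; last exact: W_cvg.
  by rewrite -[nseq _ _]rev_nseq; exact: Tbar_cvg.
rewrite [X in (_ --> X)%classic -> _](_ : _ = \sum_(j < r.+1) (-1) ^+ j.+1.-1 *
    Tbar R (nseq (r.+1 - j.+1) 1%N) * W R (k.+1 + j.+1 - 1) j.+1); last first.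
  by apply: eq_bigr => j _; rewrite mulrA subSS addSn subn1.
(* By linearity the combination of means is the mean of the partial sums of [shuffle_sum], which
   agrees termwise with the left side. *)
apply: cvg_trans; apply: near_eq_cvg; apply: nearW => N.
rewrite /arithmetic_mean /series /S /=.
under eq_bigr => j _ do rewrite mulrCA mulr_sumr.
rewrite -mulr_sumr; congr (_ * _); rewrite exchange_big; apply: eq_bigr => n _ /=.
under eq_bigr => j _ do rewrite mulr_sumr.
rewrite exchange_big; apply: eq_bigr => i _ /=.
by rewrite -[LHS]/(shuffle_sum r k i) -Tcoef_formula.
Qed.
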